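(* Let $K$ be a real number field (a subfield of $\mathbb{R}$ of finite degree over $\mathbb{Q}$) of degree $k\le 2$. Fix a $\mathbb{Q}$-vector space basis of $K$ and let $\delta_K(R)$ be the corresponding density function of the set $Tri$ of trisection numbers. Then $\delta_K(R)$ is $\mathcal{O}\bigl(R^{-\frac{2}{3}(k+1)}\bigr)$ as $R\to\infty$.
   Context: Constructibility. Let $S\subseteq\mathbb{R}^2$ contain $(0,0)$ and $(1,0)$. A point is constructible over $S$ if it can be obtained from points of $S$ by a finite sequence of straightedge-and-compass steps: (1) given two distinct points already available, one may draw the line through them, or the circle centered at one of them and passing through the other; (2) given two lines, two circles, or a line and a circle already drawn, one may add their intersection points. $C(S)$ denotes the set of all points constructible over $S$. Trisectability. An angle $\alpha$ (in radians) is identified with the point $(\cos\alpha,\sin\alpha)$ of the unit circle. $\alpha$ is trisectable if $(\cos(\alpha/3),\sin(\alpha/3))\in C(\{(0,0),(1,0),(\cos\alpha,\sin\alpha)\})$. A trisection number is a real number of the form $2\cos\alpha$ with $\alpha$ trisectable; $Tri\subseteq[-2,2]$ is the set of all trisection numbers. Height and density. Let $K$ be a subfield of $\mathbb{R}$ of finite degree $k$ over $\mathbb{Q}$, with a fixed $\mathbb{Q}$-basis $v_1,\dots,v_k$. Every $x\in K$ can be written uniquely as $x=(a_1v_1+\dots+a_kv_k)/b$ with integers $a_1,\dots,a_k,b$ having no common prime factor and $b>0$; set $h_K(x)=\max\{|a_1|,\dots,|a_k|,b\}$. For real $R>0$ let $B_K(R)=\{x\in K: h_K(x)\le R\}$,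 a finite set. For sufficiently large $R$, $$\delta_K(R)=\frac{|Tri\cap B_K(R)\cap[-2,2]|}{|B_K(R)\cap[-2,2]|}.$$ The implied constant in $\mathcal{O}$ may depend on $K$ and on the basis. *)

(* Defs.v *)
From HB Require Import structures.
From mathcomp Require Import all_boot all_order all_algebra.
From mathcomp Require Import finmap.
From mathcomp Require Import all_classical all_reals all_analysis.

Set Implicit Arguments.
Unset Strict Implicit.
Unset Printing Implicit Defensive.

Import Order.TTheory GRing.Theory Num.Theory.
Import numFieldNormedType.Exports.

Local Open Scope classical_set_scope.
Local Open Scope ring_scope.

Definition line (R : realType) (p q : R * R) : set (R * R) :=
  [set z | (z.1 - p.1) * (q.2 - p.2) = (z.2 - p.2) * (q.1 - p.1)].

Definition circle (R : realType) (p q : R * R) : set (R * R) :=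
  [set z | (z.1 - p.1) ^+ 2 + (z.2 - p.2) ^+ 2
           = (q.1 - p.1) ^+ 2 + (q.2 - p.2) ^+ 2].

(* Only distinct curves are intersected: two coinciding lines (or circles) are
   one curve, possibly drawn from different pairs of points, and its points are
   not intersection points. *)
Inductive constructible (R : realType) (S : set (R * R)) : R * R -> Prop :=
| constructible_base z : S z -> constructible S z
| constructible_inter D E z :
    drawn S D -> drawn S E -> D <> E -> D z -> E z -> constructible S z
with drawn (R : realType) (S : set (R * R)) : set (R * R) -> Prop :=
| drawn_line p q : constructible S p -> constructible S q -> p <> q ->
    drawn S (line p q)
| drawn_circle p q : constructible S p -> constructible S q -> p <> q ->
    drawn S (circle p q).

Definition trisectable (R : realType) (alpha : R) : Prop :=
  constructible [set (0, 0); (1, 0); (cos alpha, sin alpha)]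
    (cos (alpha / 3), sin (alpha / 3)).

Definition Tri (R : realType) : set R :=
  [set 2 * cos alpha | alpha in [set alpha | trisectable alpha]].

Definition is_Qbasis (R : realType) (K : {pred R}) (k : nat) (v : 'I_k -> R) :
    Prop :=
  [/\ forall i, v i \in K,
      forall c : 'I_k -> rat,
        \sum_(i < k) ratr (c i) * v i = 0 -> forall i, c i = 0
    & forall x, x \in K ->
        exists c : 'I_k -> rat, x = \sum_(i < k) ratr (c i) * v i].

Definition reduced_form (R : realType) (k : nat) (v : 'I_k -> R) (x : R)
    (a : 'I_k -> int) (b : int) : Prop :=
  [/\ 0 < b,
      x = (\sum_(i < k) (a i)%:~R * v i) / b%:~R
    & forall p : nat, prime p ->
        ~ ((forall i, (p%:Z %| a i)%Z) /\ (p%:Z %| b)%Z)].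

(* When v is a Q-basis of K and x is in K, exactly one natural number satisfies
   the condition; outside K the value is irrelevant. *)
Definition height (R : realType) (k : nat) (v : 'I_k -> R) (x : R) : nat :=
  get [set h : nat | exists (a : 'I_k -> int) (b : int),
    reduced_form v x a b /\ h = maxn (\max_(i < k) `|a i|%N) `|b|%N].

Definition height_ball (R : realType) (K : {pred R}) (k : nat) (v : 'I_k -> R)
    (r : R) : set R :=
  [set x | x \in K /\ (height v x)%:R <= r].

(* fset_set is meaningful here because height balls are finite when v is a
   Q-basis of K. *)
Definition density (R : realType) (K : {pred R}) (k : nat) (v : 'I_k -> R)
    (r : R) : R :=
  (#|` fset_set (@Tri R `&` height_ball K v r `&` `[-2, 2])|)%:R
  / (#|` fset_set (height_ball K v r `&` `[-2, 2])|)%:R.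

(* Main.v *)
Require Import Defs.
From mathcomp Require Import all_boot all_order all_algebra.
From mathcomp Require Import finmap.
From mathcomp Require Import all_classical all_reals all_analysis.
From mathcomp Require Import ring lra zify.

Set Implicit Arguments.
Unset Strict Implicit.
Unset Printing Implicit Defensive.

Import Order.TTheory GRing.Theory Num.Theory.
Import numFieldNormedType.Exports.

Local Open Scope classical_set_scope.
Local Open Scope ring_scope.

(** If [tau = 2 cos alpha] lies in [K] and [alpha] is trisectable, then
    [2 cos (alpha / 3)], a root of [t^3 - 3t = tau], lies in a tower of quadratic
    extensions of [K], so the cubic already has a root in [K].  On projective
    coordinates [t = (a1 + a2 sqrt n) / b] the map [t |-> t^3 - 3t] is given by
    cubic forms without common zero, so an effective Nullstellensatz shows that
    the height of [t] is [O(h(tau)^(1/3))].  Hence trisection numbers of height at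
    most [r] come from [O(r^((k+1)/3))] values of [t], while [K] has at least
    [c r^(k+1)] elements of height at most [r] in [[-2, 2]], because a positive
    proportion of the pairs of integers in a box are coprime. *)

(** * Constructible points and roots of the cubic *)

(* The degree of a tower never appears. What is carried from field to field is an invariant: a root
   of the cubic in the larger field forces one in [K]. Two effects could give [t^3 - 3t] a small
   height although that of [t] is large: small values of the cubic forms, and cancellation when the
   fraction is reduced. Identities over the integers with a fixed constant on the left control both.
   Degree at most two makes [K] the span of [1] and one square root, so the map has only two cubic
   forms besides [b^3], and conjugation lets the identities be written out. Passing from the given
   basis to this one costs a constant factor. The exponent is [(k + 1) / 3 - (k + 1)]. *)
Scheme constructible_mind := Minimality for constructible Sort Prop
  with drawn_mind := Minimality for drawn Sort Prop.

Record subfield (R : realType) (F : set R) : Prop := Subfield {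
  subfield1 : F 1;
  subfieldB : forall x y, F x -> F y -> F (x - y);
  subfieldM : forall x y, F x -> F y -> F (x * y);
  subfieldV : forall x, F x -> F x^-1 }.

Section Subfields.
Context {R : realType} {F : set R} (sF : subfield F).

Lemma subfield0 : F 0.
Proof.
by rewrite -(subrr 1); apply: (subfieldB sF); exact: (subfield1 sF).
Qed.

Lemma subfieldN x : F x -> F (- x).
Proof.
by move=> Fx; rewrite -sub0r; apply: (subfieldB sF) => //; exact: subfield0.
Qed.

Lemma subfieldD x y : F x -> F y -> F (x + y).
Proof.
by move=> Fx Fy; rewrite -[y]opprK; apply: (subfieldB sF) => //; exact: subfieldN.
Qed.

Lemma subfield_nat n : F n%:R.
Proof.
elim: n => [|n IH]; first exact: subfield0.
by rewrite -natr1; apply: subfieldD => //; exact: (subfield1 sF).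
Qed.

Lemma subfieldX x n : F x -> F (x ^+ n).
Proof.
move=> Fx; elim: n => [|n IH]; first by rewrite expr0; exact: (subfield1 sF).
by rewrite exprS; apply: (subfieldM sF).
Qed.

End Subfields.

Ltac subfield_tac sF := repeat first
  [ assumption | apply: (subfieldB sF) | apply: (subfieldD sF) | apply: (subfieldN
    sF)
  | apply: (subfieldM sF) | apply: (subfieldV sF) | apply: (subfieldX sF) | exact:
    (subfield_nat sF)
  | exact: (subfield1 sF) | exact: (subfield0 sF) ].

Definition adjoin (R : realType) (F : set R) (s : R) : set R :=
  [set x | exists u w, [/\ F u, F w & x = u + w * s]].

Lemma adjoin_base (R : realType) (F : set R) (s : R) :
  subfield F -> F `<=` adjoin F s.
Proof. by move=> sF x Fx; exists x, 0; split=> //; [subfield_tac sF | ring]. Qed.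

Lemma adjoin_gen (R : realType) (F : set R) (s : R) :
  subfield F -> adjoin F s s.
Proof.
by move=> sF; exists 0, 1; split; [subfield_tac sF | subfield_tac sF | ring].
Qed.

Lemma adjoin_subfield (R : realType) (F : set R) (s : R) :
  subfield F -> F (s ^+ 2) -> ~ F s -> subfield (adjoin F s).
Proof.
move=> sF Fs2 nFs; split.
- by apply: adjoin_base => //; subfield_tac sF.
- move=> _ _ [u [w [Fu Fw ->]]] [u' [w' [Fu' Fw' ->]]].
  by exists (u - u'), (w - w'); split; [subfield_tac sF | subfield_tac sF | ring].
- move=> _ _ [u [w [Fu Fw ->]]] [u' [w' [Fu' Fw' ->]]].
  exists (u * u' + w * w' * s ^+ 2), (u * w' + w * u').
  by split; [subfield_tac sF | subfield_tac sF | ring].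
- move=> _ [u [w [Fu Fw ->]]].
  have [w0|w0] := eqVneq w 0.
    by rewrite w0 mul0r addr0; apply: adjoin_base => //; subfield_tac sF.
  (* The values [e = 1] and [e = -1] cover an element and its conjugate, so the norm used in the
     inverse is nonzero; if either vanished, [s] would lie in [F]. *)
  have conj_neq0 (e : R) : e ^+ 2 = 1 -> u + e * w * s != 0.
    move=> e1; apply/eqP => uw0; apply: nFs.
    have e0 : e != 0 by apply/eqP => e0; move: e1; rewrite e0 expr0n => /esym/eqP;
      rewrite oner_eq0.
    have Fe : F e.
      have : (e - 1) * (e + 1) == 0 by rewrite -subr_sqr e1 expr1n subrr.
      rewrite mulf_eq0 => /orP[|]; first by rewrite subr_eq0 => /eqP ->;
        subfield_tac sF.
      by rewrite addr_eq0 => /eqP ->; subfield_tac sF.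
    suff -> : s = - u / (e * w) by subfield_tac sF.
    apply: (mulfI (mulf_neq0 e0 w0)).
    rewrite mulrCA divff ?mulr1 ?mulf_neq0 //.
    by apply/eqP; rewrite -addr_eq0 addrC uw0.
  have n1 : u + w * s != 0 by rewrite -[w]mul1r conj_neq0 // expr1n.
  have n2 : u - w * s != 0 by rewrite -mulNr -mulN1r conj_neq0 // sqrrN expr1n.
  have n3 : u ^+ 2 - w ^+ 2 * s ^+ 2 != 0.
    by rewrite -exprMn subr_sqr mulf_neq0.
  exists (u / (u ^+ 2 - w ^+ 2 * s ^+ 2)), (- w / (u ^+ 2 - w ^+ 2 * s ^+ 2)).
  split; [subfield_tac sF | subfield_tac sF |].
  by field; rewrite n1 exprMn n3.
Qed.

(* The three roots of [t^3 - 3t - c] sum to [0]: if [u + w s] is a root with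
   [s] quadratic over [F], so is its conjugate [u - w s], and the third root
   [- 2 u] lies in [F]. *)
Lemma adjoin_cubic_root (R : realType) (F : set R) (s c t : R) :
  subfield F -> F (s ^+ 2) -> ~ F s -> F c ->
  adjoin F s t -> t ^+ 3 - 3 * t = c -> exists2 t0, F t0 & t0 ^+ 3 - 3 * t0 = c.
Proof.
move=> sF Fs2 nFs Fc [u [w [Fu Fw ->]]] tc.
have [w0|w0] := eqVneq w 0.
  by exists u => //; rewrite -tc w0; ring.
pose A := u ^+ 3 + 3 * u * w ^+ 2 * s ^+ 2 - 3 * u - c.
pose B := 3 * u ^+ 2 * w + w ^+ 3 * s ^+ 2 - 3 * w.
have FA : F A by rewrite /A; subfield_tac sF.
have FB : F B by rewrite /B; subfield_tac sF.
have AB : A + B * s = 0 by rewrite /A /B -tc; ring.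
have B0 : B = 0.
  apply/eqP/negPn/negP => nB; apply: nFs.
  suff -> : s = - A / B by subfield_tac sF.
  by apply: (mulfI nB); rewrite mulrCA divff // mulr1; apply/eqP;
    rewrite -addr_eq0 addrC AB.
have A0 : A = 0 by move: AB; rewrite B0 mul0r addr0.
have ws : w ^+ 2 * s ^+ 2 = 3 - 3 * u ^+ 2.
  by apply: (mulfI w0); apply/eqP; rewrite -subr_eq0 -[X in _ == X]B0 /B;
    apply/eqP; ring.
exists (- (2 * u)); first by subfield_tac sF.
have -> : c = u ^+ 3 + 3 * u * (w ^+ 2 * s ^+ 2) - 3 * u.
  by apply/esym/eqP; rewrite -subr_eq0 -[X in _ == X]A0 /A; apply/eqP; ring.
by rewrite ws; ring.
Qed.

(** Stands in for [F] being reached from [K] by successive square roots: the descent of roots is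
    what the tower has to provide, and it survives each adjunction. *)
Definition root_conservative (R : realType) (K : set R) (c : R) (F : set R) :=
  [/\ subfield F, K `<=` F &
      forall t, F t -> t ^+ 3 - 3 * t = c ->
        exists2 t0, K t0 & t0 ^+ 3 - 3 * t0 = c].

Lemma root_conservative_sqrt (R : realType) (K : set R) (c : R) (F : set R)
    (s : R) :
  K c -> root_conservative K c F -> F (s ^+ 2) ->
  exists F', [/\ root_conservative K c F', F `<=` F' & F' s].
Proof.
move=> Kc gF Fs2; have [sF KF cF] := gF; have [Fs|nFs] := pselect (F s);
  first by exists F; split=> // x.
exists (adjoin F s); split; [split | exact: adjoin_base | exact: adjoin_gen].
- exact: adjoin_subfield.
- by move=> x /KF; exact: adjoin_base.
- move=> t Ft tc; have [t0 Ft0 t0c] := adjoin_cubic_root sF Fs2 nFs (KF _ Kc) Ft tc.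
  exact: cF Ft0 t0c.
Qed.

(** * Lines and circles with coefficients in a subfield, and their intersections *)

Definition line_over (R : realType) (F : set R) (D : set (R * R)) :=
  exists a b c, [/\ F a, F b, F c, a != 0 \/ b != 0 &
    D = [set z | a * z.1 + b * z.2 = c]].

Definition circle_over (R : realType) (F : set R) (D : set (R * R)) :=
  exists a b c, [/\ F a, F b, F c &
    D = [set z | z.1 ^+ 2 + z.2 ^+ 2 + a * z.1 + b * z.2 = c]].

Definition curve_over (R : realType) (F : set R) (D : set (R * R)) :=
  line_over F D \/ circle_over F D.

Lemma curve_over_sub (R : realType) (F F' : set R) (D : set (R * R)) :
  F `<=` F' -> curve_over F D -> curve_over F' D.
Proof.
move=> FF' [[a [b [c [Fa Fb Fc ab ->]]]] | [a [b [c [Fa Fb Fc ->]]]]].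
  by left; exists a, b, c; split=> //; exact: FF'.
by right; exists a, b, c; split=> //; exact: FF'.
Qed.

Lemma line_overE (R : realType) (F : set R) (p q : R * R) :
  subfield F -> F p.1 -> F p.2 -> F q.1 -> F q.2 -> p <> q ->
  line_over F (line p q).
Proof.
case: p q => [p1 p2] [q1 q2] /= sF Fp1 Fp2 Fq1 Fq2 pq.
exists (q2 - p2), (p1 - q1), (p1 * (q2 - p2) - p2 * (q1 - p1)).
split; [subfield_tac sF | subfield_tac sF | subfield_tac sF | |].
  have [e1|] := eqVneq p1 q1; last by right; rewrite subr_eq0.
  have [e2|] := eqVneq q2 p2; last by left; rewrite subr_eq0.
  by case: pq; rewrite e1 e2.
by apply/seteqP; split=> -[x y]; rewrite /line /circle /= => e; apply/eqP;
  rewrite -subr_eq0;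
  move/eqP: e; rewrite -subr_eq0 => /eqP e; apply/eqP; rewrite -[RHS]e; ring.
Qed.

Lemma circle_overE (R : realType) (F : set R) (p q : R * R) :
  subfield F -> F p.1 -> F p.2 -> F q.1 -> F q.2 ->
  circle_over F (circle p q).
Proof.
case: p q => [p1 p2] [q1 q2] /= sF Fp1 Fp2 Fq1 Fq2.
exists (- (2 * p1)), (- (2 * p2)),
  ((q1 - p1) ^+ 2 + (q2 - p2) ^+ 2 - p1 ^+ 2 - p2 ^+ 2).
split; [subfield_tac sF | subfield_tac sF | subfield_tac sF |].
by apply/seteqP; split=> -[x y]; rewrite /line /circle /= => e; apply/eqP;
  rewrite -subr_eq0;
  move/eqP: e; rewrite -subr_eq0 => /eqP e; apply/eqP; rewrite -[RHS]e; ring.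
Qed.

Section Intersections.
Context {R : realType} {K : set R} {c0 : R} (Kc0 : K c0).

Let reach (F : set R) (z : R * R) :=
  exists F', [/\ root_conservative K c0 F', F `<=` F', F' z.1 & F' z.2].

Lemma line_quadratic_reach (F : set R) (a b c d e f : R) (z : R * R) :
  root_conservative K c0 F -> F a -> F b -> F c -> F d -> F e -> F f ->
  b != 0 -> a * z.1 + b * z.2 = c ->
  z.1 ^+ 2 + z.2 ^+ 2 + d * z.1 + e * z.2 = f -> reach F z.
Proof.
case: z => x y /= gF Fa Fb Fc Fd Fe Ff b0 l q; have [sF _ _] := gF.
pose A := b ^+ 2 + a ^+ 2.
pose B := b ^+ 2 * d - 2 * a * c - a * b * e.
pose C := c ^+ 2 + b * c * e - b ^+ 2 * f.
have A0 : 2 * A != 0.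
  rewrite mulf_neq0 ?pnatr_eq0 // /A gt_eqF // ltr_wpDr ?sqr_ge0 //.
  by rewrite lt_neqAle sqr_ge0 eq_sym sqrf_eq0 b0.
have root : A * x ^+ 2 + B * x + C = 0.
  have -> : A * x ^+ 2 + B * x + C =
     b ^+ 2 * (x ^+ 2 + y ^+ 2 + d * x + e * y - f)
     + (c - a * x - b * y) * (c - a * x + b * y + b * e) by rewrite /A /B /C; ring.
  by rewrite q -l; ring.
(* [2 A x + B] is a square root of the discriminant, hence the only element to adjoin. *)
have Fs : F ((2 * A * x + B) ^+ 2).
  have -> : (2 * A * x + B) ^+ 2 = B ^+ 2 - 4 * A * C.
    apply/eqP; rewrite -subr_eq0; apply/eqP.
    by transitivity (4 * A * (A * x ^+ 2 + B * x + C)); [ring | rewrite root mulr0].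
  by rewrite /A /B /C; subfield_tac sF.
have [F' [gF' FF' F's]] := root_conservative_sqrt Kc0 gF Fs.
have [sF' _ _] := gF'.
have [Fa' Fb' Fc'] : [/\ F' a, F' b & F' c] by split; exact: FF'.
have [FA FB] : F' A /\ F' B by split; apply: FF'; rewrite /A /B; subfield_tac sF.
have Fx : F' x.
  suff -> : x = ((2 * A * x + B) - B) / (2 * A) by subfield_tac sF'.
  by rewrite addrK mulrAC divff // mul1r.
exists F'; split=> //=.
suff -> : y = (c - a * x) / b by subfield_tac sF'.
by rewrite -l addrAC subrr add0r mulrAC divff // mul1r.
Qed.

Lemma line_circle_reach (F : set R) (a b c d e f : R) (z : R * R) :
  root_conservative K c0 F -> F a -> F b -> F c -> F d -> F e -> F f ->
  a != 0 \/ b != 0 -> a * z.1 + b * z.2 = c ->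
  z.1 ^+ 2 + z.2 ^+ 2 + d * z.1 + e * z.2 = f -> reach F z.
Proof.
move=> gF Fa Fb Fc Fd Fe Ff ab l q.
have [b0|b0] := eqVneq b 0; last exact: (line_quadratic_reach gF Fa Fb Fc Fd Fe Ff).
have a0 : a != 0 by case: ab => //; rewrite b0 eqxx.
(* A vertical line is handled by exchanging the coordinates. *)
have [|||F' [gF' FF' Fy Fx]] :=
  @line_quadratic_reach F b a c e d f (z.2, z.1) gF Fb Fa Fc Fe Fd Ff => //=.
- by rewrite addrC.
- by rewrite -q; ring.
- by exists F'.
Qed.

Lemma inter_reach (F : set R) (D E : set (R * R)) (z : R * R) :
  root_conservative K c0 F -> curve_over F D -> curve_over F E -> D <> E ->
  D z -> E z -> reach F z.
Proof.
move=> gF; have [sF _ _] := gF.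
move=> [] [a [b [c]]].
- move=> [Fa Fb Fc ab ->] [] [d [e [f]]].
  + move=> [Fd Fe Ff de ->] neq /= l1 l2.
    case: z l1 l2 => x y /= l1 l2.
    (* A nonzero determinant gives the point inside [F] by Cramer's rule; a zero one makes two lines
       with a common point equal. *)
    have [det0|det0] := eqVneq (a * e - b * d) 0; last first.
      exists F; split=> //=.
        suff -> : x = (c * e - b * f) / (a * e - b * d) by subfield_tac sF.
        apply: (mulIf det0); rewrite mulfVK // -l1 -l2; ring.
      suff -> : y = (a * f - c * d) / (a * e - b * d) by subfield_tac sF.
      by apply: (mulIf det0); rewrite mulfVK // -l1 -l2; ring.
    case: neq.
    have [k k0 [dk ek]] : exists2 k, k != 0 & d = k * a /\ e = k * b.
      case: ab => [a0|b0].
        have e1 : d = d / a * a by rewrite mulfVK.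
        have e2 : e = d / a * b.
          have ae : a * e = d * b by apply/eqP; rewrite -subr_eq0 [d * b]mulrC det0.
          by rewrite mulrAC -ae mulrAC divff // mul1r.
        exists (d / a) => //; apply/eqP => k0.
        by case: de => /eqP; [rewrite e1|rewrite e2]; rewrite k0 mul0r.
      have e1 : e = e / b * b by rewrite mulfVK.
      have e2 : d = e / b * a.
        have bd : b * d = e * a by apply/esym/eqP;
          rewrite -subr_eq0 [e * a]mulrC det0.
        by rewrite mulrAC -bd mulrAC divff // mul1r.
      exists (e / b) => //; apply/eqP => k0.
      by case: de => /eqP; [rewrite e2|rewrite e1]; rewrite k0 mul0r.
    have fk : f = k * c by rewrite -l2 -l1 dk ek; ring.
    apply/seteqP; split=> -[x' y'] /= h.
      by rewrite dk ek fk -h; ring.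
    by apply: (mulfI k0); rewrite -fk -h dk ek; ring.
  + move=> [Fd Fe Ff ->] neq /= l1 l2.
    exact: (line_circle_reach gF Fa Fb Fc Fd Fe Ff).
- move=> [Fa Fb Fc ->] [] [d [e [f]]].
  + move=> [Fd Fe Ff de ->] neq /= l1 l2.
    exact: (line_circle_reach gF Fd Fe Ff Fa Fb Fc).
  + move=> [Fd Fe Ff ->] neq /= l1 l2.
    (* Subtracting the equations leaves the radical axis. Its coefficients cannot both vanish, since
       concentric circles with a common point coincide. *)
    apply: (@line_circle_reach F (a - d) (b - e) (c - f) a b c) => //;
      [subfield_tac sF| subfield_tac sF|subfield_tac sF| |].
      have [ad|] := eqVneq a d; last by left; rewrite subr_eq0.
      have [be|] := eqVneq b e; last by right; rewrite subr_eq0.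
      by case: neq; rewrite -ad -be -l1 -l2 ad be.
    by rewrite -l1 -l2; ring.
Qed.

(** The quantifier over all [F] lets extensions be stacked: the field for the second point or curve
    is built over the one for the first. *)
Lemma constructible_reach (S : set (R * R)) :
  (forall z F, S z -> root_conservative K c0 F -> reach F z) ->
  forall z, constructible S z ->
  forall F, root_conservative K c0 F -> reach F z.
Proof.
move=> HS.
pose P0 D := forall F, root_conservative K c0 F ->
  exists F', [/\ root_conservative K c0 F', F `<=` F' & curve_over F' D].
have two (p q : R * R) F :
    (forall F, root_conservative K c0 F -> reach F p) ->
    (forall F, root_conservative K c0 F -> reach F q) ->
    root_conservative K c0 F ->
  exists F', root_conservative K c0 F' /\ [/\ F `<=` F', F' p.1, F' p.2,
    F' q.1 & F' q.2].
  move=> Hp Hq /Hp [F1 [gF1 s1 p1 p2]].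
  have [F2 [gF2 s2 q1 q2]] := Hq _ gF1.
  exists F2; split=> //; split=> //; [|exact: s2|exact: s2].
  by move=> x /s1 /s2.
apply: (@constructible_mind R S _ P0) => //.
- by move=> z Sz F gF; exact: HS.
- move=> D E z _ PD _ PE neq Dz Ez F gF.
  have [F1 [gF1 s1 D1]] := PD _ gF.
  have [F2 [gF2 s2 E2]] := PE _ gF1.
  have [F3 [gF3 s3 z1 z2]] := inter_reach gF2 (curve_over_sub s2 D1) E2 neq Dz Ez.
  by exists F3; split=> // x /s1 /s2 /s3.
- move=> p q _ Pp _ Pq pq F gF.
  have [F' [gF' [sub p1 p2 q1 q2]]] := two p q F Pp Pq gF.
  have [sF' _ _] := gF'.
  by exists F'; split=> //; left; exact: line_overE.
- move=> p q _ Pp _ Pq pq F gF.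
  have [F' [gF' [sub p1 p2 q1 q2]]] := two p q F Pp Pq gF.
  have [sF' _ _] := gF'.
  by exists F'; split=> //; right; exact: circle_overE.
Qed.

End Intersections.

Lemma cos_triple (R : realType) (x : R) : cos (3 * x) = 4 * cos x ^+ 3 - 3 * cos x.
Proof.
have -> : 3 * x = x + x + x by ring.
rewrite !cosD !sinD.
have -> : (cos x * cos x - sin x * sin x) * cos x
    - (sin x * cos x + cos x * sin x) * sin x =
  cos x ^+ 3 - 3 * cos x * sin x ^+ 2 by ring.
by rewrite sin2cos2; ring.
Qed.

Lemma Tri_cubic_root (R : realType) (K : divringClosed R) (tau : R) :
  tau \in K -> Tri tau -> exists2 t, t \in K & t ^+ 3 - 3 * t = tau.
Proof.
move=> Ktau [alpha tri tauE].
pose K' := [set x : R | x \in K].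
have sK : subfield K'.
  by split=> [|x y Kx Ky|x y Kx Ky|x Kx];
    [exact: rpred1|exact: rpredB|exact: rpredM|rewrite /K' /= rpredV].
have gK : root_conservative K' tau K' by split=> // t Kt tc; exists t.
have Kcos : K' (cos alpha).
  suff -> : cos alpha = tau / 2 by apply: (subfieldM sK) => //;
    apply: (subfieldV sK); exact: (subfield_nat sK).
  by rewrite -tauE mulrC mulKf // pnatr_eq0.
have [|F [[sF _ cF] _ Ft _]] :=
    @constructible_reach R K' tau Ktau _ _ _ tri K' gK.
  move=> z F [[|]|] -> gF; have [sF KF _] := gF.
  - by exists F; split=> //=; subfield_tac sF.
  - by exists F; split=> //=; subfield_tac sF.
  (* Of the three base points only this one may leave [F], and one square root reaches it. *)
  have Fs : F (sin alpha ^+ 2).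
    by rewrite sin2cos2; have := KF _ Kcos; move=> ?; subfield_tac sF.
  have [F' [gF' FF' F's]] := root_conservative_sqrt Ktau gF Fs.
  by exists F'; split=> //=; apply: FF'; exact: KF.
apply: (cF (2 * cos (alpha / 3))); first by subfield_tac sF.
rewrite -tauE -[in RHS](@divfK _ 3 _ alpha) ?pnatr_eq0 // [_ * 3]mulrC cos_triple.
ring.
Qed.

(** * The cubic map on coordinates *)

(** Keeps of a form of degree [k] only its growth on boxes, which sums and products respect. *)
Definition bounded_form (k : nat) (F : int -> int -> int -> int) :=
  exists2 C : int, 0 <= C & forall a1 a2 b M : int,
    `|a1| <= M -> `|a2| <= M -> `|b| <= M ->
    `|F a1 a2 b| <= C * M ^+ k.

Lemma bounded_formD k F G : bounded_form k F -> bounded_form k G ->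
  bounded_form k (fun a1 a2 b => F a1 a2 b + G a1 a2 b).
Proof.
move=> [C C0 HF] [C' C'0 HG]; exists (C + C'); first exact: addr_ge0.
move=> a1 a2 b M h1 h2 h3.
by rewrite mulrDl (le_trans (ler_normD _ _)) // lerD ?HF ?HG.
Qed.

Lemma bounded_formM j k F G : bounded_form j F -> bounded_form k G ->
  bounded_form (j + k) (fun a1 a2 b => F a1 a2 b * G a1 a2 b).
Proof.
move=> [C C0 HF] [C' C'0 HG]; exists (C * C'); first exact: mulr_ge0.
move=> a1 a2 b M h1 h2 h3.
by rewrite normrM exprD mulrACA ler_pM ?HF ?HG.
Qed.

Lemma bounded_formZ k c F : bounded_form k F ->
  bounded_form k (fun a1 a2 b => c * F a1 a2 b).
Proof.
move=> [C C0 HF]; exists (`|c| * C); first exact: mulr_ge0.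
move=> a1 a2 b M h1 h2 h3.
by rewrite normrM -mulrA ler_pM ?HF.
Qed.

Lemma bounded_form_fst : bounded_form 1 (fun a1 _ _ => a1).
Proof. by exists 1 => // a1 a2 b M; rewrite mul1r. Qed.
Lemma bounded_form_snd : bounded_form 1 (fun _ a2 _ => a2).
Proof. by exists 1 => // a1 a2 b M; rewrite mul1r. Qed.
Lemma bounded_form_thd : bounded_form 1 (fun _ _ b => b).
Proof. by exists 1 => // a1 a2 b M; rewrite mul1r. Qed.

Section Nullstellensatz.
Context (n : int).

(* [(a1 + a2 sqrt n)^3 - 3 (a1 + a2 sqrt n) b^2 = cubic1 + cubic2 sqrt n]. *)
Definition cubic1 (a1 a2 b : int) :=
  a1 ^+ 3 + 3 * n * a1 * a2 ^+ 2 - 3 * a1 * b ^+ 2.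
Definition cubic2 (a1 a2 b : int) :=
  3 * a1 ^+ 2 * a2 + n * a2 ^+ 3 - 3 * a2 * b ^+ 2.

(* With [alpha = a1 + a2 sqrt n] and conjugate [alpha'], we have
   [alpha^2 = s + m sqrt n], [alpha alpha' = N] and [alpha^4 = S + T sqrt n].
   Expanding [(alpha + alpha')^9] gives [512 a1^9 = alpha^5 U + alpha'^5 U'] with
   [U = u1 + u2 sqrt n]; [(alpha - alpha')^9] gives [w1 + w2 sqrt n] and [a2]
   likewise.  Finally [alpha^5 = (alpha^2 + 3 b^2) (alpha^3 - 3 alpha b^2)
   + 9 alpha b b^3] brings in the cubic forms. *)
Let s (a1 a2 b : int) := a1 * a1 + n * (a2 * a2).
Let m (a1 a2 b : int) := 2 * (a1 * a2).
Let N (a1 a2 b : int) := a1 * a1 + (- n) * (a2 * a2).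
Let S a1 a2 b := s a1 a2 b * s a1 a2 b + n * (m a1 a2 b * m a1 a2 b).
Let T a1 a2 b := 2 * (s a1 a2 b * m a1 a2 b).

(** Modulo [alpha^3 - 3 alpha b^2], the fifth power of [alpha] is the first divisible by [b^3], and
    9 is the least exponent for which every binomial term contains [alpha^5] or [alpha'^5]. With the
    binomial coefficients 1, 9, 36, 84, 126 one gets 127 = 1 + 126, 93 = 9 + 84, -125 = 1 - 126 and
    -75 = 9 - 84; the signs alternate for [w1] and [w2]. *)
Let u1 a1 a2 b := 127 * S a1 a2 b + 93 * (N a1 a2 b * s a1 a2 b)
  + 36 * (N a1 a2 b * N a1 a2 b).
Let u2 a1 a2 b := - 125 * T a1 a2 b + - 75 * (N a1 a2 b * m a1 a2 b).
Let w1 a1 a2 b := 127 * S a1 a2 b + - 93 * (N a1 a2 b * s a1 a2 b)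
  + 36 * (N a1 a2 b * N a1 a2 b).
Let w2 a1 a2 b := - 125 * T a1 a2 b + 75 * (N a1 a2 b * m a1 a2 b).
Let sb a1 a2 b := s a1 a2 b + 3 * (b * b).

Let bs : bounded_form 2 s.
Proof.
by apply: bounded_formD; [|apply: bounded_formZ];
  apply: (bounded_formM (j := 1) (k := 1));
    (exact: bounded_form_fst || exact: bounded_form_snd).
Qed.
Let bm : bounded_form 2 m.
Proof.
by apply: bounded_formZ; apply: (bounded_formM (j := 1) (k := 1));
  (exact: bounded_form_fst || exact: bounded_form_snd).
Qed.
Let bN : bounded_form 2 N.
Proof.
by apply: bounded_formD; [|apply: bounded_formZ];
  apply: (bounded_formM (j := 1) (k := 1));
    (exact: bounded_form_fst || exact: bounded_form_snd).
Qed.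
Let bsb : bounded_form 2 sb.
Proof.
by apply: bounded_formD => //; apply: bounded_formZ;
  apply: (bounded_formM (j := 1) (k := 1)); exact: bounded_form_thd.
Qed.
Let bS : bounded_form 4 S.
Proof.
by apply: bounded_formD; [|apply: bounded_formZ];
  exact: (bounded_formM (j := 2) (k := 2)).
Qed.
Let bT : bounded_form 4 T.
Proof. by apply: bounded_formZ; exact: (bounded_formM (j := 2) (k := 2)). Qed.
Let bu1 : bounded_form 4 u1.
Proof.
by apply: bounded_formD; [apply: bounded_formD|]; apply: bounded_formZ => //;
  exact: (bounded_formM (j := 2) (k := 2)).
Qed.
Let bu2 : bounded_form 4 u2.
Proof.
by apply: bounded_formD; apply: bounded_formZ => //;
  exact: (bounded_formM (j := 2) (k := 2)).
Qed.
Let bw1 : bounded_form 4 w1.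
Proof.
by apply: bounded_formD; [apply: bounded_formD|]; apply: bounded_formZ => //;
  exact: (bounded_formM (j := 2) (k := 2)).
Qed.
Let bw2 : bounded_form 4 w2.
Proof.
by apply: bounded_formD; apply: bounded_formZ => //;
  exact: (bounded_formM (j := 2) (k := 2)).
Qed.

(** The factor [n ^+ 4] gives both coordinates the same constant: it arises for [a2], where
    [(2 a2 sqrt n)^9] carries [n^4 sqrt n]. *)
Lemma cubic_nullstellensatz1 : exists G1 G2 G3,
  [/\ bounded_form 6 G1, bounded_form 6 G2, bounded_form 6 G3 &
   forall a1 a2 b, 256 * n ^+ 4 * a1 ^+ 9 =
     G1 a1 a2 b * cubic1 a1 a2 b + G2 a1 a2 b * cubic2 a1 a2 b
       + G3 a1 a2 b * b ^+ 3].
Proof.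
exists (fun a1 a2 b =>
    n ^+ 4 * (sb a1 a2 b * u1 a1 a2 b + n * (m a1 a2 b * u2 a1 a2 b))),
  (fun a1 a2 b =>
    n ^+ 4 * (n * (m a1 a2 b * u1 a1 a2 b) + n * (sb a1 a2 b * u2 a1 a2 b))),
  (fun a1 a2 b => n ^+ 4 * (9 * (b * (a1 * u1 a1 a2 b + n * (a2 * u2 a1 a2 b))))).
split.
- by apply: bounded_formZ; apply: bounded_formD; [|apply: bounded_formZ];
  exact: (bounded_formM (j := 2) (k := 4)).
- by apply: bounded_formZ; apply: bounded_formD; apply: bounded_formZ;
  exact: (bounded_formM (j := 2) (k := 4)).
- apply: bounded_formZ; apply: bounded_formZ;
  apply: (bounded_formM (j := 1) (k := 5) bounded_form_thd).
  apply: bounded_formD; [|apply: bounded_formZ];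
    apply: (bounded_formM (j := 1) (k := 4)) => //.
    exact: bounded_form_fst.
  exact: bounded_form_snd.
move=> a1 a2 b; rewrite /cubic1 /cubic2 /sb /u1 /u2 /S /T /N /m /s; ring.
Qed.

Lemma cubic_nullstellensatz2 : exists G1 G2 G3,
  [/\ bounded_form 6 G1, bounded_form 6 G2, bounded_form 6 G3 &
   forall a1 a2 b, 256 * n ^+ 4 * a2 ^+ 9 =
     G1 a1 a2 b * cubic1 a1 a2 b + G2 a1 a2 b * cubic2 a1 a2 b
       + G3 a1 a2 b * b ^+ 3].
Proof.
exists (fun a1 a2 b => sb a1 a2 b * w2 a1 a2 b + m a1 a2 b * w1 a1 a2 b),
  (fun a1 a2 b => n * (m a1 a2 b * w2 a1 a2 b) + sb a1 a2 b * w1 a1 a2 b),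
  (fun a1 a2 b => 9 * (b * (a1 * w2 a1 a2 b + a2 * w1 a1 a2 b))).
split.
- by apply: bounded_formD; exact: (bounded_formM (j := 2) (k := 4)).
- by apply: bounded_formD; [apply: bounded_formZ|];
  exact: (bounded_formM (j := 2) (k := 4)).
- apply: bounded_formZ; apply: (bounded_formM (j := 1) (k := 5) bounded_form_thd).
  apply: bounded_formD; apply: (bounded_formM (j := 1) (k := 4)) => //.
    exact: bounded_form_fst.
  exact: bounded_form_snd.
move=> a1 a2 b; rewrite /cubic1 /cubic2 /sb /w1 /w2 /S /T /N /m /s; ring.
Qed.

End Nullstellensatz.

(** * Divisibility and coprime families of integers *)

Definition coprime_family (I : finType) (a : I -> int) (b : int) :=
  forall p : nat, prime p -> ~ ((forall i, (p%:Z %| a i)%Z) /\ (p%:Z %| b)%Z).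

Lemma dvdz_of_no_prime (g D : int) :
  g != 0 -> (forall p : nat,
    prime p -> ~ (p%:Z %| (g %/ gcdz g D)%Z)%Z) -> (g %| D)%Z.
Proof.
move=> g0 H.
have d0 : gcdz g D != 0 by rewrite gcdz_eq0 negb_and g0.
have gE : g = (g %/ gcdz g D)%Z * gcdz g D by rewrite divzK // dvdz_gcdl.
have q1 : `|(g %/ gcdz g D)%Z|%N = 1%N.
  case: (posnP `|(g %/ gcdz g D)%Z|%N) => [/eqP|q0].
    rewrite absz_eq0 => /eqP q0; move: g0; rewrite gE q0 mul0r eqxx //.
  apply/eqP/negPn/negP => q1.
  have lt1 : (1 < `|(g %/ gcdz g D)%Z|)%N by rewrite ltn_neqAle eq_sym q1.
  by apply: (H _ (pdiv_prime lt1)); rewrite dvdzE /=; exact: pdiv_dvd.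
apply: (@dvdz_trans (gcdz g D)); last exact: dvdz_gcdr.
by rewrite dvdzE {1}gE abszM q1 mul1n.
Qed.

Lemma dvdz_divgcd (g D x : int) :
  g != 0 -> (g %| D * x)%Z -> ((g %/ gcdz g D)%Z %| x)%Z.
Proof.
move=> g0 gDx.
have d0 : gcdz g D != 0 by rewrite gcdz_eq0 negb_and g0.
have cp : coprimez (g %/ gcdz g D)%Z (D %/ gcdz g D)%Z.
  rewrite /coprimez -(inj_eq (mulIf d0)) mul1r; apply/eqP.
  by have := mulz_gcdl (g %/ gcdz g D)%Z (D %/ gcdz g D)%Z (gcdz g D);
    rewrite !divzK ?dvdz_gcdl ?dvdz_gcdr.
rewrite -(Gauss_dvdzr _ cp) -(dvdz_mul2r d0) divzK ?dvdz_gcdl //.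
by rewrite mulrAC divzK ?dvdz_gcdr.
Qed.

Lemma dvdz_combination (g x y z u v w : int) :
  (g %| x)%Z -> (g %| y)%Z -> (g %| z)%Z -> (g %| u * x + v * y + w * z)%Z.
Proof.
move=> /dvdzP[x' ->] /dvdzP[y' ->] /dvdzP[z' ->]; apply/dvdzP.
by exists (u * x' + v * y' + w * z'); ring.
Qed.

Lemma dvdz_le (x y : int) : 0 < y -> (x %| y)%Z -> x <= y.
Proof.
move=> y0; rewrite dvdzE => /dvdn_leq le_xy.
have := le_xy ltac:(by rewrite absz_gt0 gt_eqF); lia.
Qed.

(** A prime in the part of [g] missed by [D] would divide every [a i ^+ j] and [b ^+ k], hence the
    whole coprime family. *)
Lemma coprime_family_dvd_expr (I : finType) (a : I ->
  int) (b g D : int) (j k : nat) :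
  coprime_family a b -> g != 0 ->
  (forall i, (g %| D * a i ^+ j)%Z) -> (g %| D * b ^+ k)%Z -> (g %| D)%Z.
Proof.
move=> cop g0 ga gb; apply: dvdz_of_no_prime => // p pp pg.
have prime_dvd x i : (g %| D * x ^+ i)%Z -> (p%:Z %| x)%Z.
  move=> gx.
  have : ((g %/ gcdz g D)%Z %| x ^+ i)%Z by exact: dvdz_divgcd.
  move=> /(dvdz_trans pg); rewrite !dvdzE /= abszX.
  case: i {gx} => [|i]; first by rewrite expn0 dvdn1 => /eqP p1; rewrite p1 in pp.
  by rewrite Euclid_dvdX // => /andP[].
by apply: (cop p pp); split=> [i|]; [exact: prime_dvd (ga i) | exact: prime_dvd gb].
Qed.

Lemma coprime_family_reduce (I : finType) (a : I -> int) (b : int) : 0 < b ->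
  exists a' b' g, [/\ coprime_family a' b', 0 < b', 0 < g, forall i,
    a i = g * a' i & b = g * b'].
Proof.
have [N] := ubnP `|b|%N; elim: N a b => // N IH a b bN b0.
have [cop|] := pselect (coprime_family a b).
  by exists a, b, 1; split=> // [i|]; rewrite mul1r.
move=> /existsNP[p /not_implyP[pp /contrapT [pa pb]]].
have p0 : 0 < p%:Z by rewrite ltz_nat prime_gt0.
have [||a' [b' [g [cop b'0 g0 aE bE]]]] := IH (fun i => (a i %/ p)%Z) (b %/ p)%Z.
- move: pb => /dvdzP[c bc]; move: bN b0;
  rewrite bc mulzK ?gt_eqF // abszM ltnS => bN.
  rewrite pmulr_lgt0 // => c0; apply: leq_trans bN.
  by rewrite ltn_Pmulr ?prime_gt1 //= absz_gt0 gt_eqF.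
- by rewrite -(ltr_pM2r p0) mul0r divzK.
exists a', b', (p%:Z * g); split=> // [|i|].
- exact: mulr_gt0.
- by rewrite -mulrA -aE mulrC divzK.
- by rewrite -mulrA -bE mulrC divzK.
Qed.

Lemma common_denominator (I : finType) (c : I -> rat) :
  exists2 m : int, 0 < m & exists a : I -> int, forall i, c i * m%:~R = (a i)%:~R.
Proof.
exists (\prod_i denq (c i)); first by apply: prodr_gt0 => i _; exact: denq_gt0.
exists (fun i => numq (c i) * \prod_(j | j != i) denq (c j)) => i.
by rewrite (bigD1 i) //= !intrM mulrA -numqE.
Qed.

(** [(f1 : f2 : b)] and [(c1 : c2 : e)] represent the same projective point. A combination of the
    first triple is traded for one of the second, whose entries are bounded in the application. *)
Lemma proportional_combination (x1 x2 x3 f1 f2 b c1 c2 e : int) :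
  f1 * e = c1 * b -> f2 * e = c2 * b ->
  (x1 * f1 + x2 * f2 + x3 * b) * e = b * (x1 * c1 + x2 * c2 + x3 * e).
Proof.
move=> e1 e2; rewrite !mulrDl -!mulrA e1 e2; ring.
Qed.

Lemma bounded_form_combination (G1 G2 G3 : int -> int -> int -> int) (k : nat) :
  bounded_form k G1 -> bounded_form k G2 -> bounded_form k G3 ->
  exists2 C : int, 0 <= C & forall a1 a2 b M c1 c2 e H : int,
    `|a1| <= M -> `|a2| <= M -> `|b| <= M ->
    `|c1| <= H -> `|c2| <= H -> `|e| <= H ->
    `|G1 a1 a2 b * c1 + G2 a1 a2 b * c2 + G3 a1 a2 b * e| <= C * M ^+ k * H.
Proof.
move=> [C1 C10 H1] [C2 C20 H2] [C3 C30 H3].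
exists (C1 + C2 + C3); first by rewrite !addr_ge0.
move=> a1 a2 b M c1 c2 e H h1 h2 h3 hc1 hc2 he.
rewrite !mulrDl (le_trans (ler_normD _ _)) // lerD //; last first.
  by rewrite normrM ler_pM ?H3.
by rewrite (le_trans (ler_normD _ _)) // lerD // normrM ler_pM ?H1 ?H2.
Qed.

Lemma ge0_le_add3 (x y z : int) : 0 <= x -> 0 <= y -> 0 <= z ->
  [/\ x <= x + y + z, y <= x + y + z & z <= x + y + z].
Proof. by move=> *; split; lia. Qed.

(* [g = b^3 / gcd (b^3, e)] divides both cubic forms and [b^3], hence, by the
   Nullstellensatz identities and coprimality, the constant [D = 256 n^4]: so
   little cancels in [t^3 - 3t], and the same identities bound the size. *)
Lemma cubic_height_bound (n : int) : n != 0 -> exists2 C : int, 0 < C &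
  forall (I : finType) (a : I -> int) (i1 i2 : I) (b c1 c2 e H : int),
    (forall i, i = i1 \/ i = i2) ->
    coprime_family a b -> 0 < b -> 0 < e ->
    cubic1 n (a i1) (a i2) b * e = c1 * b ^+ 3 ->
    cubic2 n (a i1) (a i2) b * e = c2 * b ^+ 3 ->
    `|c1| <= H -> `|c2| <= H -> e <= H ->
    [/\ `|a i1| ^+ 3 <= C * H, `|a i2| ^+ 3 <= C * H & b ^+ 3 <= C * H].
Proof.
move=> n0.
have [G1 [G2 [G3 [bG1 bG2 bG3 G_eq]]]] := cubic_nullstellensatz1 n.
have [K1 [K2 [K3 [bK1 bK2 bK3 K_eq]]]] := cubic_nullstellensatz2 n.
have [CG CG0 HG] := bounded_form_combination bG1 bG2 bG3.
have [CK CK0 HK] := bounded_form_combination bK1 bK2 bK3.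
set D := 256 * n ^+ 4 in G_eq K_eq.
have D0 : 0 < D.
  by rewrite mulr_gt0 // lt_neqAle eq_sym expf_neq0 //= (exprM n 2 2) sqr_ge0.
clearbody D.
exists (D + CG + CK); first by rewrite -addrA ltr_wpDr // addr_ge0.
move=> I a i1 i2 b c1 c2 e H i12 cop b0 e0 f1 f2 hc1 hc2 he.
have H0 : 0 < H by exact: lt_le_trans he.
have b30 : 0 < b ^+ 3 by exact: exprn_gt0.
pose g := (b ^+ 3 %/ gcdz (b ^+ 3) e)%Z.
have gE : b ^+ 3 = g * gcdz (b ^+ 3) e by rewrite divzK // dvdz_gcdl.
have d0 : gcdz (b ^+ 3) e != 0 by rewrite gcdz_eq0 negb_and gt_eqF.
have g0 : g != 0 by apply: contraTneq b30 => g0; rewrite gE g0 mul0r.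
have gf f c : f * e = c * b ^+ 3 -> (g %| f)%Z.
  move=> fe; apply: dvdz_divgcd; first by rewrite gt_eqF.
  by rewrite mulrC fe dvdz_mull.
have gb : (g %| b ^+ 3)%Z by rewrite gE dvdz_mulr.
have gD : (g %| D)%Z.
  apply: (coprime_family_dvd_expr (j := 9) (k := 3) cop g0) => [i|];
    last exact: dvdz_mull.
  by case: (i12 i) => ->; [rewrite (G_eq _ (a i2) b) | rewrite (K_eq (a i1) _ b)];
    apply: dvdz_combination => //; (exact: gf f1 || exact: gf f2).
(* [b ^+ 3] is [g] times a divisor of [e], and [g] divides [D]. *)
have bDe : b ^+ 3 <= D * e.
  rewrite gE ler_pM //; last by rewrite dvdz_le // dvdz_gcdr.
    rewrite ltW //; move: b30; rewrite gE pmulr_lgt0 //.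
    by rewrite lt_neqAle eq_sym d0.
  exact: dvdz_le.
pose M := Num.max `|a i1| (Num.max `|a i2| b).
have M1 : `|a i1| <= M by rewrite le_max lexx.
have M2 : `|a i2| <= M by rewrite !le_max lexx orbT.
have M3 : b <= M by rewrite !le_max lexx !orbT.
have M3' : `|b| <= M by rewrite gtr0_norm.
have he' : `|e| <= H by rewrite gtr0_norm.
have M0 : 0 < M by exact: lt_le_trans M3.
have [DC CGC CKC] := ge0_le_add3 (ltW D0) CG0 CK0.
set C := D + CG + CK in DC CGC CKC *.
(* By [bDe], [D e |x|^9 = b^3 |Y| <= D e |Y|], and [D e] cancels. *)
have bound x Y C' : D * x ^+ 9 * e = b ^+ 3 * Y -> `|Y| <= C' * M ^+ 6 * H ->
    0 <= C' -> C' <= C -> `|x| ^+ 9 <= C * M ^+ 6 * H.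
  move=> xY YC C'0 C'C.
  have De0 : 0 < D * e by exact: mulr_gt0.
  rewrite -(ler_pM2l De0).
  have -> : D * e * `|x| ^+ 9 = b ^+ 3 * `|Y|.
    rewrite -normrX -(gtr0_norm De0) -normrM -(gtr0_norm b30) -normrM -xY.
    by rewrite mulrAC.
  apply: ler_pM => //; first exact: ltW.
  apply: (le_trans YC).
  by rewrite (ler_pM2r H0) ler_pM2r ?exprn_gt0.
(* The identity for the coordinate attaining the maximum is used; if that is [b], [bDe] gives the
   bound directly. *)
have M9 : M ^+ 9 <= C * M ^+ 6 * H.
  rewrite {1}/M; case: (leP `|a i1|) => _; last first.
    apply: (bound _ _ _ _ (HG _ _ _ _ _ _ _ _ M1 M2 M3' hc1 hc2 he')) => //.
    by rewrite (G_eq _ (a i2) b); apply: (proportional_combination _ _ _ f1 f2).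
  case: (leP `|a i2|) => _; last first.
    apply: (bound _ _ _ _ (HK _ _ _ _ _ _ _ _ M1 M2 M3' hc1 hc2 he')) => //.
    by rewrite (K_eq (a i1) _ b); apply: (proportional_combination _ _ _ f1 f2).
  rewrite (exprD b 3 6) [leRHS]mulrAC; apply: ler_pM.
  - exact: ltW.
  - exact/ltW/exprn_gt0.
  - by apply: (le_trans bDe); apply: ler_pM => //; exact: ltW.
  - by apply: lerXn2r => //; rewrite nnegrE ltW.
have M3H : M ^+ 3 <= C * H.
  rewrite -(ler_pM2r (exprn_gt0 6 M0)) -exprD.
  by rewrite [leRHS]mulrAC.
have le3 x : 0 <= x -> x <= M -> x ^+ 3 <= C * H.
  by move=> x0 xM; apply: le_trans M3H; rewrite lerXn2r // nnegrE // ltW.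
by split; apply: le3 => //; exact: ltW.
Qed.

(** * Coprime pairs in a box *)

Lemma sum_inv_sqr_le (F : realFieldType) (n : nat) :
  \sum_(2 <= d < n) (d%:R ^- 2 : F) <= 3 / 4.
Proof.
(* Telescoping with [1 / (x + 1)^2 <= 1 / x - 1 / (x + 1)]; the case [m = 0] is an equality and
   fixes [3 / 4 = 1 / 4 + 1 / 2]. *)
suff H m : \sum_(2 <= d < m.+3) (d%:R ^- 2 : F) <= 3 / 4 - m.+2%:R^-1.
  case: n => [|[|[|m]]]; try by rewrite big_geq //; lra.
  by apply: (le_trans (H m)); rewrite gerBl invr_ge0.
elim: m => [|m IH]; first by rewrite big_nat1; lra.
rewrite big_nat_recr //=; apply: (le_trans (lerD IH (lexx _))).
have m2 : 0 < m.+2%:R :> F by rewrite ltr0Sn.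
have -> : m.+3%:R = m.+2%:R + 1 :> F by rewrite -natr1.
rewrite -subr_ge0.
have -> : 3 / 4 - (m.+2%:R + 1)^-1 - (3 / 4 - m.+2%:R^-1 + (m.+2%:R + 1) ^- 2)
  = (m.+2%:R : F)^-1 * (m.+2%:R + 1) ^- 2.
  by field; rewrite !gt_eqF // ?addr_gt0.
by rewrite mulr_ge0 // invr_ge0 ?exprn_ge0 ?addr_ge0 // ltW.
Qed.

Lemma sum_ltn_minn (q L : nat) : (\sum_(j < L) (j < q) = minn L q)%N.
Proof.
elim: L => [|L IH]; first by rewrite big_ord0 min0n.
rewrite big_ord_recr /= IH; lia.
Qed.

Lemma sum_dvdn (d N : nat) : (\sum_(i < N) (d %| i.+1) = N %/ d)%N.
Proof. by rewrite divn_count_dvd big_add1 /= big_mkord. Qed.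

(** Union bound: pairs with a common divisor [d >= 2] make up at most [3 / 4] of the box and those
    with small [j] at most [1 / 8], which leaves [1 / 8]. The condition on [j] will keep
    denominators large enough for quotients to stay in [[-2, 2]]. *)
Lemma count_coprime_pairs (N L : nat) :
  (N * L <= 8 * \sum_(i < N) \sum_(j < L)
    (coprime i.+1 j.+1 && (L < 8 * j.+1)))%N.
Proof.
set P := (\sum_(i < N) _)%N.
have cover : (N * L <= P + N * (L %/ 8)
    + \sum_(2 <= d < N.+1) (N %/ d) * (L %/ d))%N.
  have -> : (N * L = \sum_(i < N) \sum_(j < L) 1)%N.
    by rewrite sum_nat_const card_ord sum1_card card_ord.
  have -> : (\sum_(2 <= d < N.+1) (N %/ d) * (L %/ d) =
     \sum_(i < N) \sum_(j < L) \sum_(2 <= d < N.+1) (d %| i.+1) * (d %| j.+1))%N.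
    under [in RHS]eq_bigr do rewrite exchange_big /=.
    rewrite exchange_big /=; apply: eq_bigr => d _.
    by rewrite -(sum_dvdn d N) -(sum_dvdn d L) big_distrlr.
  have -> : (N * (L %/ 8) = \sum_(i < N) \sum_(j < L) (j < L %/ 8))%N.
    by rewrite sum_nat_const card_ord sum_ltn_minn; congr (_ * _)%N; lia.
  rewrite /P -!big_split /=; apply: leq_sum => i _.
  rewrite -!big_split /=; apply: leq_sum => j _.
  have [cop|ncop] := boolP (coprime i.+1 j.+1).
    have [//|h] := ltnP L (8 * j.+1); have -> : (j < L %/ 8)%N by lia.
    by [].
  have g2 : (1 < gcdn i.+1 j.+1)%N.
    by rewrite ltn_neqAle eq_sym ncop gcdn_gt0.
  have gN : (gcdn i.+1 j.+1 < N.+1)%N.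
    by rewrite ltnS (leq_trans (dvdn_leq _ (dvdn_gcdl _ _))).
  rewrite (bigD1_seq (gcdn i.+1 j.+1)) ?iota_uniq ?mem_index_iota ?g2 //=.
  by rewrite dvdn_gcdl dvdn_gcdr; lia.
have bound : (4 * \sum_(2 <= d < N.+1) (N %/ d) * (L %/ d) <= 3 * (N * L))%N.
  rewrite -(ler_nat rat) natrM natr_sum.
  have : \sum_(2 <= d < N.+1) ((N %/ d * (L %/ d))%:R : rat)
      <= (N * L)%:R * \sum_(2 <= d < N.+1) (d%:R ^- 2 : rat).
    rewrite mulr_sumr; apply: ler_sum_nat => d /andP[d2 _].
    have d0 : (0 < d%:R :> rat) by rewrite ltr0n; lia.
    rewrite ler_pdivlMr ?exprn_gt0 // -natrX -natrM ler_nat.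
    have := leq_trunc_div N d; have := leq_trunc_div L d => h1 h2.
    by apply: leq_trans (leq_mul h2 h1); lia.
  have := sum_inv_sqr_le rat N.+1.
  have : 0 <= (N * L)%:R :> rat by [].
  rewrite [in (_ <= (3 * _)%:R)]natrM; nra.
have := leq_trunc_div L 8.
nia.
Qed.

(** * Heights and height balls *)

Lemma card_fset_set_le (T : choiceType) (A : set T) (s : seq T) :
  A `<=` [set` s] -> (#|` fset_set A| <= size s)%N.
Proof.
move=> As; have fA : finite_set A by apply: sub_finite_set As _; exact: finite_seq.
apply: uniq_leq_size; first exact: fset_uniq.
by move=> x; rewrite in_fset_set // inE => /As.
Qed.

Lemma le_card_fset_set (T : choiceType) (A : set T) (s : seq T) :
  finite_set A -> uniq s -> [set` s] `<=` A -> (size s <= #|` fset_set A|)%N.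
Proof.
move=> fA us sA; apply: uniq_leq_size => // x xs.
by rewrite in_fset_set // inE; exact: sA.
Qed.

Section Heights.
Context {R : realType} {K : divringClosed R} {k : nat} {v : 'I_k -> R}.
Context (hv : is_Qbasis K v).

Lemma Qbasis_int_eq0 (c : 'I_k -> int) :
  \sum_i (c i)%:~R * v i = 0 -> forall i, c i = 0.
Proof.
case: hv => _ indep _ sum0 i; apply/eqP; rewrite -(intr_eq0 rat); apply/eqP.
apply: (indep (fun i => (c i)%:~R)); rewrite -[RHS]sum0.
by apply: eq_bigr => j _; rewrite ratr_int.
Qed.

(** Determines the value that [get] picks in [height]. After cross-multiplication, coprimality makes
    each denominator divide the other. *)
Lemma reduced_form_unique (x : R) (a a' : 'I_k -> int) (b b' : int) :
  reduced_form v x a b -> reduced_form v x a' b' -> a =1 a' /\ b = b'.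
Proof.
move=> [b0 xE cop] [b'0 xE' cop'].
have ab i : a i * b' = a' i * b.
  apply/eqP; rewrite -subr_eq0; apply/eqP; move: i.
  apply: Qbasis_int_eq0.
  have bR : b%:~R != 0 :> R by rewrite intr_eq0 gt_eqF.
  have b'R : b'%:~R != 0 :> R by rewrite intr_eq0 gt_eqF.
  have : (\sum_i (a i)%:~R * v i) * b'%:~R = (\sum_i (a' i)%:~R * v i) * b%:~R.
    apply/eqP; rewrite -eqr_div //; apply/eqP; rewrite -xE; exact: xE'.
  move/eqP; rewrite -subr_eq0 !mulr_suml -sumrB => /eqP sum0; rewrite -[RHS]sum0.
  by apply: eq_bigr => i _; rewrite intrB !intrM; ring.
have dvd (c c' : 'I_k -> int) (d d' : int) : coprime_family c d -> 0 < d ->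
    (forall i, c i * d' = c' i * d) -> (d %| d')%Z.
  move=> cop_cd d0 cd.
  apply: (coprime_family_dvd_expr (j := 1) (k := 1) cop_cd);
    first by rewrite gt_eqF.
    by move=> i; rewrite expr1 mulrC cd dvdz_mull.
  by rewrite expr1 dvdz_mull.
have bb' : b = b'.
  apply/eqP; rewrite eq_le; apply/andP; split; apply: dvdz_le => //.
    exact: dvd cop b0 ab.
  by apply: (dvd _ a _ _ cop' b'0) => i; rewrite ab.
split=> // i; apply: (mulIf (_ : b != 0)); first by rewrite gt_eqF.
by rewrite -ab bb'.
Qed.

Lemma reduced_form_exists (x : R) : x \in K ->
  exists a b, reduced_form v x a b.
Proof.
case: hv => _ _ /[apply] -[c xE].
have [m m0 [a aE]] := common_denominator c.
have [a' [b' [g [cop b'0 g0 aE' bE']]]] := coprime_family_reduce a m0.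
exists a', b'; split=> //.
have gR : g%:~R != 0 :> R by rewrite intr_eq0 gt_eqF.
have bR : b'%:~R != 0 :> R by rewrite intr_eq0 gt_eqF.
rewrite xE mulr_suml; apply: eq_bigr => i _.
have -> : c i = (a i)%:~R / m%:~R.
  by rewrite -aE mulfK // intr_eq0 gt_eqF.
rewrite aE' bE' !intrM fmorph_div !rmorphM /= !ratr_int.
by field; rewrite bR gR.
Qed.

Lemma height_reduced_form (x : R) (a : 'I_k -> int) (b : int) :
  reduced_form v x a b -> height v x = maxn (\max_(i < k) `|a i|%N) `|b|%N.
Proof.
move=> rf.
have [a' [b' [rf' ->]]] : [set h | exists (a : 'I_k -> int) (b : int),
    reduced_form v x a b /\ h = maxn (\max_(i < k) `|a i|%N) `|b|%N] (height v x).
  by apply: getPex; exists (maxn (\max_(i < k) `|a i|%N) `|b|%N), a, b.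
have [aa' ->] := reduced_form_unique rf' rf.
by congr maxn; apply: eq_bigr => i _; rewrite aa'.
Qed.

Lemma height_ball_form (r x : R) : height_ball K v r x ->
  exists a b, [/\ reduced_form v x a b, forall i, `|a i|%:~R <= r & b%:~R <= r].
Proof.
move=> [xK hx]; have [a [b rf]] := reduced_form_exists xK.
exists a, b; split=> //.
  move=> i; apply: le_trans hx; rewrite (height_reduced_form rf).
  rewrite -abszE -pmulrn ler_nat leq_max; apply/orP; left.
  exact: (leq_bigmax (F := fun i => `|a i|%N)).
apply: le_trans hx; rewrite (height_reduced_form rf); case: rf => b0 _ _.
by rewrite -[in X in X <= _](gtr0_norm b0) -abszE -pmulrn ler_nat leq_max leqnn
  orbT.
Qed.

(** [fset_set] sends infinite sets to the empty one, so the lower bound for the denominator of the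
    density rests on this. *)
Lemma finite_height_ball (r : R) : finite_set (height_ball K v r).
Proof.
pose n := Num.trunc r.
pose G (t : {ffun 'I_k -> 'I_(n + n).+1} * 'I_n.+1) : R :=
  (\sum_i ((t.1 i)%:Z - n%:Z)%:~R * v i) / (t.2 : nat)%:R.
apply: (@sub_finite_set _ _ [set` codom G]); last exact: finite_seq.
move=> x /height_ball_form[a [b [[b0 xE _] ar br]]].
have le_n (z : int) : `|z|%:~R <= r -> (`|z| <= n)%N.
  rewrite -abszE -pmulrn => zr; have := truncnS_gt r.
  by rewrite -/n => rn; have := le_lt_trans zr rn; rewrite ltr_nat ltnS.
have an i : (`|a i| <= n)%N by exact: le_n.
have bn : (`|b| <= n)%N by apply: le_n; rewrite gtr0_norm.
apply/codomP; exists ([ffun i => inord (absz (a i + n%:Z))], inord `|b|%N).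
rewrite xE /G /=; congr (_ / _).
  apply: eq_bigr => i _; rewrite ffunE inordK; last by have := an i; lia.
  by congr (_%:~R * _); have := an i; lia.
by rewrite inordK ?ltnS // -[in LHS](gtr0_norm b0) -abszE -pmulrn.
Qed.

End Heights.

(** Numerators run over [1..N], denominators over [1..m N]. Coprimality of the first numerator with
    the denominator already makes the form reduced, so distinct choices give distinct elements. *)
Lemma height_ball_card_ge (R : realType) (K : divringClosed R) (k : nat)
    (v : 'I_k.+1 -> R) : is_Qbasis K v ->
  exists2 m : nat, (0 < m)%N & forall (N : nat) (r : R), (m * N)%:R <= r ->
    (N ^ k.+2 <= 8 * #|` fset_set (height_ball K v r `&` `[(-2)%R, 2%R])|)%N.
Proof.
move=> hv; pose V := \sum_i `|v i|.
have V0 : 0 <= V by rewrite sumr_ge0.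
(* The denominator exceeds [m N / 8] and the sum above it is at most [N V] in absolute value, so
   [4 V <= m] keeps the quotient in [[-2, 2]]. *)
pose m := (Num.trunc (4 * V)).+1.
have Vm : 4 * V <= m%:R by rewrite ltW // truncnS_gt.
exists m => // N r Nr; set L := (m * N)%N.
pose a (t : 'I_N * 'I_L * {ffun 'I_k -> 'I_N}) (i : 'I_k.+1) : nat :=
  if unlift ord0 i is Some j then (t.2 j).+1 else t.1.1.+1.
pose F (t : 'I_N * 'I_L * {ffun 'I_k -> 'I_N}) : R :=
  (\sum_i (a t i)%:Z%:~R * v i) / (t.1.2.+1)%:Z%:~R.
pose Q := [pred p : 'I_N * 'I_L | coprime p.1.+1 p.2.+1 && (L < 8 * p.2.+1)%N].
pose P := [predX Q & (predT : pred {ffun 'I_k -> 'I_N})].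
have aN t i : (a t i <= N)%N by rewrite /a; case: unlift => [j|].
have rf t : t \in P -> reduced_form v (F t) (fun i => (a t i)%:Z) (t.1.2.+1)%:Z.
  rewrite !inE andbT => /andP[cop _]; split=> // p pp [pa pb].
  have := pa ord0; rewrite /a unlift_none => pa0.
  have : (p %| gcdn t.1.1.+1 t.1.2.+1)%N by rewrite dvdn_gcd; apply/andP; split.
  by rewrite (eqP cop) dvdn1 => /eqP p1; rewrite p1 in pp.
have Finj : {in P &, injective F}.
  move=> [[i j] g] [[i' j'] g'] tP t'P FE.
  have := rf _ t'P; rewrite -FE => /(reduced_form_unique hv (rf _ tP)) [aE bE].
  have jE : j = j' by apply/val_inj; case: bE.
  have iE : i = i'.
    by apply/val_inj; have := aE ord0; rewrite /a unlift_none => -[].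
  have gE : g = g'.
    by apply/ffunP => l; apply/val_inj; have := aE (lift ord0 l);
      rewrite /a liftK => -[].
  by rewrite iE jE gE.
have cardP : (N ^ k.+2 <= 8 * #|P|)%N.
  rewrite cardX cardT -cardT card_ffun !card_ord mulnA expnSr expnSr -mulnA mulnC
    leq_mul2r.
  apply/orP; right; apply: (@leq_trans (N * L)).
    by rewrite leq_mul2l leq_pmull ?orbT.
  apply: (leq_trans (count_coprime_pairs N L)); rewrite leq_mul2l /=.
  rewrite pair_big /= -sum1_card [leqRHS]big_mkcond /=.
  by apply: leq_sum => p _; rewrite [_ \in Q]inE; case: (_ && _).
apply: (leq_trans cardP); rewrite leq_mul2l /= cardE -(size_map F).
apply: le_card_fset_set.
- exact/finite_setIl/finite_height_ball.
- rewrite map_inj_in_uniq ?enum_uniq // => s t; rewrite !mem_enum; exact: Finj.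
move=> x /= /mapP[t]; rewrite mem_enum => tP ->{x}; split; first split.
- apply: rpred_div; last exact: rpred_int.
  by apply: rpred_sum => i _; apply: rpredM; [exact: rpred_int | case: hv].
- rewrite (height_reduced_form hv (rf _ tP)); apply: le_trans Nr.
  rewrite ler_nat geq_max; apply/andP; split; last by rewrite /= ltn_ord.
  by apply/bigmax_leqP => i _; rewrite (leq_trans (aN t i)) // leq_pmull.
have b0 : 0 < (t.1.2.+1)%:Z%:~R :> R by rewrite ltr0z.
have Lb : L%:R <= 8 * (t.1.2.+1)%:Z%:~R :> R.
  by move: tP; rewrite !inE andbT => /andP[_ /ltnW]; rewrite -(ler_nat R) natrM.
have sumNV : `|\sum_i (a t i)%:Z%:~R * v i| <= N%:R * V.
  apply: (le_trans (ler_norm_sum _ _ _)); rewrite mulr_sumr; apply: ler_sum => i _.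
  rewrite normrM; apply: ler_wpM2r => //.
  by rewrite ger0_norm ?ler0z // -pmulrn ler_nat.
rewrite in_itv /= -ler_norml normrM normfV (gtr0_norm b0) ler_pdivrMr //.
apply: (le_trans sumNV); move: Lb Vm; rewrite /L natrM.
have : 0 <= N%:R :> R by [].
nra.
Qed.

(** * Coordinates in a field of degree at most two *)

(* [K] is the rational span of [1] and [theta = sqrt n]; degree one is covered by
   forcing the second coordinate to vanish. *)
Definition sqrt_generated (R : realType) (K : {pred R}) (k : nat) (theta : R)
    (n : int) :=
  [/\ n != 0, theta ^+ 2 = n%:~R,
      forall p q : rat, (k = 1%N -> q = 0) -> ratr p + ratr q * theta = 0 ->
        p = 0 /\ q = 0
    & forall x, x \in K -> exists p q : rat,
      (k = 1%N -> q = 0) /\ x = ratr p + ratr q * theta].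

Lemma sqrt_generated_quadratic (R : realType) (K : divringClosed R) (w : R) :
  w \in K -> (forall q : rat, w <> ratr q) ->
  (forall x, x \in K -> exists p q : rat, x = ratr p + ratr q * w) ->
  exists theta n, sqrt_generated K 2 theta n.
Proof.
move=> wK wirr span.
have [s [u w2]] := span _ (rpredM wK wK).
(* Completing the square in [w^2 = s + u w] gives [theta0 ^+ 2 = rho]; scaling by [denq rho] makes
   the square an integer. *)
pose rho := s + u ^+ 2 / 4.
pose theta0 := w - ratr (u / 2).
have theta02 : theta0 ^+ 2 = ratr rho.
  rewrite /theta0 /rho rmorphD /= !fmorph_div /= !rmorphXn /= !ratr_nat.
  have -> : (w - ratr u / 2) ^+ 2 = w * w - ratr u * w + ratr u ^+ 2 / 4 by field.
  by rewrite w2; field.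
have den0 : (denq rho)%:~R != 0 :> R by rewrite intr_eq0 denq_neq0.
pose theta := (denq rho)%:~R * theta0.
have w_theta : w = ratr (u / 2) + ratr ((denq rho)%:~R^-1) * theta.
  rewrite /theta mulrA fmorphV /= ratr_int mulVf // mul1r /theta0; ring.
have theta2 : theta ^+ 2 = (denq rho * numq rho)%:~R.
  rewrite exprMn theta02 intrM -(ratr_int _ (numq rho)) numqE rmorphM /= ratr_int;
    ring.
exists theta, (denq rho * numq rho); split=> //.
- rewrite -(intr_eq0 R) -theta2 sqrf_eq0; apply/eqP => theta_eq0.
  by apply: (wirr (u / 2)); rewrite w_theta theta_eq0; ring.
- move=> p q _; have [->|q0] := eqVneq q 0.
    by rewrite rmorph0 mul0r addr0 => /eqP; rewrite fmorph_eq0 => /eqP.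
  move=> pq; exfalso; apply: (wirr (u / 2 - (denq rho)%:~R^-1 * (p / q))).
  have qR : ratr q != 0 :> R by rewrite fmorph_eq0.
  have -> : w = ratr (u / 2) + ratr ((denq rho)%:~R^-1) *
     ((ratr p + ratr q * theta) / ratr q - ratr p / ratr q).
    by rewrite {1}w_theta; congr (_ + _ * _); field.
  by rewrite pq mul0r sub0r mulrN -fmorph_div -rmorphM -rmorphB.
move=> x /span[p [q ->]].
exists (p + q * (u / 2)), (q * (denq rho)%:~R^-1); split=> //.
rewrite {1}w_theta rmorphD /= !rmorphM /=; ring.
Qed.

Lemma Qbasis_sqrt_generated (R : realType) (K : divringClosed R) (k : nat)
    (v : 'I_k -> R) : is_Qbasis K v -> (k <= 2)%N ->
  exists theta n, sqrt_generated K k theta n.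
Proof.
case: k v => [|[|[|//]]] v [vK indep span] _.
- have [c] := span 1 (rpred1 _); rewrite big_ord0 => /eqP.
  by rewrite oner_eq0.
- have [c] := span 1 (rpred1 _); rewrite big_ord_recl big_ord0 addr0 => c1.
  have c0 : c ord0 != 0.
    by apply/eqP => c0; move: c1; rewrite c0 rmorph0 mul0r => /eqP;
      rewrite oner_eq0.
  have v0 : v ord0 = ratr (c ord0)^-1.
    apply: (mulfI (_ : ratr (c ord0) != 0)); first by rewrite fmorph_eq0.
    by rewrite -c1 -rmorphM mulfV ?rmorph1.
  exists 1, 1; split=> //; first by rewrite expr1n.
    move=> p q /(_ erefl) ->; rewrite rmorph0 mul0r addr0 => /eqP.
    by rewrite fmorph_eq0 => /eqP.
  move=> x /span[d ->]; rewrite big_ord_recl big_ord0 addr0 v0 -rmorphM.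
  by exists (d ord0 / c ord0), 0; split=> //; rewrite rmorph0 mul0r addr0.
set i0 : 'I_2 := ord0; set i1 : 'I_2 := lift ord0 ord0.
have sum2 (c : 'I_2 -> rat) :
    \sum_(i < 2) ratr (c i) * v i = ratr (c i0) * v i0 + ratr (c i1) * v i1.
  by rewrite big_ord_recl big_ord1.
have indep2 (x y : rat) : ratr x * v i0 + ratr y * v i1 = 0 -> x = 0 /\ y = 0.
  move=> xy; have := indep (fun i => if i == i0 then x else y).
  rewrite sum2 /= => /(_ xy) H; split; first exact: (H i0).
  exact: (H i1).
have [c] := span 1 (rpred1 _); rewrite sum2 => c1.
(* In [1 = c0 v0 + c1 v1], a zero [c1] makes [v0] rational, so [v1] is an irrational generator; a
   nonzero [c1] makes [v0] one. *)
have [y0|y0] := eqVneq (c i1) 0.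
  move: c1; rewrite y0 rmorph0 mul0r addr0 => c1.
  have x0 : c i0 != 0.
    by apply/eqP => x0; move: c1; rewrite x0 rmorph0 mul0r => /eqP;
      rewrite oner_eq0.
  have x0R : ratr (c i0) != 0 :> R by rewrite fmorph_eq0.
  have v0 : v i0 = ratr (c i0)^-1.
    by apply: (mulfI x0R); rewrite -c1 -rmorphM mulfV ?rmorph1.
  apply: (sqrt_generated_quadratic (vK i1)).
    move=> q vq; have [|_] := indep2 (q * c i0) (- 1).
      by rewrite rmorphM rmorphN1 /= -mulrA -c1 vq; ring.
    by move=> /eqP; rewrite oppr_eq0 oner_eq0.
  move=> x /span[d ->]; exists (d i0 / c i0), (d i1).
  by rewrite sum2 v0 rmorphM.
have y0R : ratr (c i1) != 0 :> R by rewrite fmorph_eq0.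
apply: (sqrt_generated_quadratic (vK i0)).
  move=> q vq; have [|h1 h2] := indep2 (1 - q * c i0) (- (q * c i1)).
    rewrite rmorphB rmorphN !rmorphM rmorph1 /=.
    have -> : (1 - ratr q * ratr (c i0)) * v i0 + - (ratr q * ratr (c i1)) * v i1
      = v i0 - ratr q * (ratr (c i0) * v i0 + ratr (c i1) * v i1) by ring.
    by rewrite -c1 vq; ring.
  move/eqP: h2; rewrite oppr_eq0 mulf_eq0 (negbTE y0) orbF => /eqP q0.
  by move/eqP: h1; rewrite q0 mul0r subr0 oner_eq0.
move=> x /span[d ->]; exists (d i1 / c i1), (d i0 - d i1 * c i0 / c i1).
rewrite sum2 rmorphB !fmorph_div /= rmorphM /=.
have -> : v i1 = (1 - ratr (c i0) * v i0) / ratr (c i1).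
  by rewrite {1}c1 addrAC subrr add0r mulrC mulKf.
by field.
Qed.

(** [rho] is the cube root of the radius. The constant absorbs the change from [v] to [1, theta],
    and only the coordinates of [t] in the latter are bounded. *)
Lemma cubic_root_coords (R : realType) (K : divringClosed R) (k : nat)
    (v : 'I_k -> R) (theta : R) (n : int) :
  is_Qbasis K v -> sqrt_generated K k theta n ->
  exists2 C : R, 1 <= C & forall rho tau t : R, 1 <= rho ->
    height_ball K v (rho ^+ 3) tau -> t \in K -> t ^+ 3 - 3 * t = tau ->
  exists a1 a2 b : int,
    [/\ `|a1|%:~R <= C * rho, `|a2|%:~R <= C * rho, `|b|%:~R <= C * rho,
        k = 1%N -> a2 = 0 & t = (a1%:~R + a2%:~R * theta) / b%:~R].
Proof.
move=> hv [n0 theta2 indep span].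
have indepZ (x y : int) : (k = 1%N -> y = 0) -> x%:~R + y%:~R * theta = 0 ->
  x = 0 /\ y = 0.
  move=> y1 xy; have [||/eqP x0 /eqP y0] := indep x%:~R y%:~R.
  - by move=> /y1 ->.
  - by rewrite !ratr_int.
  by move: x0 y0; rewrite !intr_eq0 => /eqP ? /eqP ?.
have vspan i : exists pq : rat * rat,
    (k = 1%N -> pq.2 = 0) /\ v i = ratr pq.1 + ratr pq.2 * theta.
  have [vK _ _] := hv; have [p [q pqE]] := span _ (vK i); by exists (p, q).
have [pq pqP] := choice vspan.
have [m m0 [V VE]] := common_denominator
  (fun ib : 'I_k * bool => if ib.2 then (pq ib.1).1 else (pq ib.1).2).
have vE i : v i * m%:~R = (V (i, true))%:~R + (V (i, false))%:~R * theta.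
  have := VE (i, true); have := VE (i, false) => /= e2 e1.
  have [_ ->] := pqP i.
  by rewrite -(ratr_int R (V (i, true))) -(ratr_int R (V (i,
    false))) -e1 -e2 !rmorphM /= !ratr_int; ring.
have VF i : k = 1%N -> V (i, false) = 0.
  move=> k1; have := VE (i, false); rewrite /= ((pqP i).1 k1) mul0r => /esym/eqP.
  by rewrite intr_eq0 => /eqP.
have [C1 C10 HC1] := cubic_height_bound n0.
pose H0 : int := m + \sum_i `|V (i, true)| + \sum_i `|V (i, false)|.
have [mH V1H V2H] : [/\ m <= H0, \sum_i `|V (i, true)| <= H0
    & \sum_i `|V (i, false)| <= H0].
  by apply: ge0_le_add3; rewrite ?sumr_ge0 // ltW.
have H01 : 1 <= H0 by exact: le_trans mH.
exists (C1 * H0)%:~R.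
  by rewrite -[1]/(1%:~R) ler_int; exact: mulr_ege1.
move=> rho tau t rho1 /(height_ball_form hv)[a [b [[b0 tauE _] ar br]]] tK tcub.
pose N : int := Num.trunc (rho ^+ 3).
have rho30 : 0 <= rho ^+ 3 by rewrite exprn_ge0 // (le_trans _ rho1).
have NrR : N%:~R <= rho ^+ 3.
  by have /andP[] := truncn_itv rho30; rewrite /N -pmulrn.
have le_N (z : int) : z%:~R <= rho ^+ 3 -> z <= N.
  move=> zr; have := le_lt_trans zr (truncnS_gt (rho ^+ 3)).
  rewrite pmulrn ltr_int /N; move: (Num.trunc _) => T; clear; lia.
have aN i : `|a i| <= N by exact: le_N.
have bN : b <= N by exact: le_N.
pose c1 := \sum_i a i * V (i, true).
pose c2 := \sum_i a i * V (i, false).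
have tauE' : tau * (m * b)%:~R = c1%:~R + c2%:~R * theta.
  rewrite tauE intrM mulrCA divfK ?intr_eq0 ?gt_eqF // mulr_sumr.
  rewrite /c1 /c2 !rmorph_sum /= mulr_suml -big_split /=; apply: eq_bigr => i _.
  by rewrite mulrCA [m%:~R * _]mulrC vE !intrM; ring.
have [p [q [q1 tE]]] := span _ tK.
(* The index [true] stands for the coordinate along [1], [false] for the one along [theta]. *)
have [m' m'0 [A AE]] := common_denominator (fun i : bool => if i then p else q).
have [A' [d [g [cop d0 g0 AE' dE]]]] := coprime_family_reduce A m'0.
have dR : d%:~R != 0 :> R by rewrite intr_eq0 gt_eqF.
have gR : g%:~R != 0 :> R by rewrite intr_eq0 gt_eqF.
have A'E i : ratr (if i then p else q) = (A' i)%:~R / d%:~R :> R.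
  have AR : ratr (if i then p else q) * m'%:~R = (A i)%:~R :> R.
    by rewrite -(ratr_int R m') -rmorphM /= AE ratr_int.
  apply: (mulIf gR); apply: (mulIf dR); rewrite -mulrA -intrM -dE AR AE' intrM.
  by field.
have tE' : t = ((A' true)%:~R + (A' false)%:~R * theta) / d%:~R.
  by rewrite tE (A'E true) (A'E false); field.
have A'F : k = 1%N -> A' false = 0.
  move=> /q1 q0; have /eqP := A'E false;
    rewrite q0 rmorph0 eq_sym mulf_eq0 invr_eq0 (negbTE dR) orbF.
  by rewrite intr_eq0 => /eqP.
pose f1 := cubic1 n (A' true) (A' false) d.
pose f2 := cubic2 n (A' true) (A' false) d.
have ftau : (f1%:~R + f2%:~R * theta) = tau * (d ^+ 3)%:~R.
  rewrite -tcub tE' /f1 /f2 /cubic1 /cubic2.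
  rewrite !(rmorphB, rmorphD, rmorphM, rmorphXn) /= -theta2.
  by field.
have [e1 e2] : f1 * (m * b) = c1 * d ^+ 3 /\ f2 * (m * b) = c2 * d ^+ 3.
  have [||/eqP h1 /eqP h2] := indepZ (f1 * (m * b) - c1 * d ^+ 3) (f2 * (m * b) -
    c2 * d ^+ 3).
  - move=> k1; rewrite /f2 /cubic2 (A'F k1) /c2 big1; first by rewrite expr0n /=;
    ring.
    by move=> i _; rewrite VF // mulr0.
  - rewrite !intrB (intrM _ f1 (m * b)) (intrM _ f2 (m * b)) (intrM _ c1 (d ^+ 3))
    (intrM _ c2 (d ^+ 3)).
    transitivity ((f1%:~R + f2%:~R * theta) * (m * b)%:~R
      - (c1%:~R + c2%:~R * theta) * (d ^+ 3)%:~R); first by ring.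
    by rewrite ftau -tauE'; ring.
  by move: h1 h2; rewrite !subr_eq0 => /eqP ? /eqP ?.
have bool2 (i : bool) : i = true \/ i = false by case: i; [left|right].
have N0 : 0 <= N by [].
have cN (W : 'I_k -> int) : \sum_i `|W i| <= H0 -> `|\sum_i a i * W i| <= H0 * N.
  move=> WH; apply: (le_trans (ler_norm_sum _ _ _)).
  apply: (@le_trans _ _ (\sum_i `|W i| * N)).
    by apply: ler_sum => i _; rewrite normrM mulrC ler_wpM2l.
  by rewrite -mulr_suml ler_wpM2r.
have [] := HC1 _ A' true false d c1 c2 (m * b) (H0 * N) bool2 cop d0 _ e1 e2.
- exact: mulr_gt0.
- exact: cN.
- exact: cN.
- by apply: ler_pM => //; exact: ltW.
move=> b1 b2 b3.
(* [C1 * H0] is at least [1], hence at most its own cube, so it may leave the cube root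
   unchanged. *)
have root3 (z : int) : 0 <= z -> z ^+ 3 <= C1 * (H0 * N) ->
  z%:~R <= (C1 * H0)%:~R * rho.
  move=> z0 z3; have C0 : 1 <= C1 * H0 by exact: mulr_ege1.
  have CR1 : 1 <= (C1 * H0)%:~R :> R by rewrite -[1]/(1%:~R) ler_int.
  have rho0 : 0 <= rho by exact: le_trans rho1.
  rewrite -(@ler_pXn2r _ 3) // ?nnegrE ?ler0z // ?mulr_ge0 //;
    last by rewrite (le_trans _ CR1).
  rewrite exprMn; apply: (@le_trans _ _ ((C1 * H0)%:~R * rho ^+ 3)).
    apply: (@le_trans _ _ ((C1 * H0)%:~R * N%:~R)).
      by rewrite -rmorphXn /= -intrM ler_int -mulrA.
    by rewrite ler_wpM2l // (le_trans _ CR1).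
  by rewrite ler_wpM2r // ler_eXnr.
exists (A' true), (A' false), d; split=> //; try exact: root3.
by apply: root3; rewrite ?gtr0_norm // ltW.
Qed.

(** * The density estimate *)

Lemma Qbasis_gt0 (R : realType) (K : divringClosed R) (k : nat)
    (v : 'I_k -> R) : is_Qbasis K v -> (0 < k)%N.
Proof.
case: k v => // v [_ _ span]; have [c] := span 1 (rpred1 _).
by rewrite big_ord0 => /eqP; rewrite oner_eq0.
Qed.

Lemma Tri_height_ball_card_le (R : realType) (K : divringClosed R) (k : nat)
    (v : 'I_k -> R) : is_Qbasis K v -> (k <= 2)%N ->
  exists2 C : R, 0 < C & forall rho : R, 1 <= rho ->
    (#|` fset_set (@Tri R `&` height_ball K v (rho ^+ 3) `&` `[-2, 2])|)%:R
      <= (C * rho) ^+ k.+1.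
Proof.
move=> hv k2; have k0 := Qbasis_gt0 hv.
have [theta [n sg]] := Qbasis_sqrt_generated hv k2.
have [C C1 coords] := cubic_root_coords hv sg.
(* Each coordinate will take [2 X + 1] values, at most [3 C rho] because [1 <= C rho]. *)
exists (3 * C) => [|rho rho1]; first by rewrite mulr_gt0 // (lt_le_trans _ C1).
have Crho1 : 1 <= C * rho by exact: mulr_ege1.
pose X := Num.trunc (C * rho).
have XC : X%:R <= C * rho.
  by have /andP[] := truncn_itv (le_trans ler01 Crho1).
have le_X (z : int) : `|z|%:~R <= C * rho -> (`|z| <= X)%N.
  rewrite -abszE -pmulrn => zr; have := le_lt_trans zr (truncnS_gt _).
  by rewrite ltr_nat ltnS.
pose T := {ffun 'I_k.+1 -> 'I_(X + X).+1}.
pose z (g : T) (i : nat) : int := (g (inord i) : nat)%:Z - X%:Z.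
(* Index [0] holds the first numerator, [k] the denominator, and [1] the second numerator when
   [k = 2]. Codes with denominator zero only enlarge the upper bound. *)
pose t (g : T) : R :=
  ((z g 0%N)%:~R + (if k == 1%N then 0 else (z g 1%N)%:~R) * theta) / (z g k)%:~R.
pose s := codom (fun g => t g ^+ 3 - 3 * t g).
have sub : @Tri R `&` height_ball K v (rho ^+ 3) `&` `[-2, 2] `<=` [set` s].
  move=> tau [[tri ball] _] /=.
  have [x xK xcub] := Tri_cubic_root ball.1 tri.
  have [a1 [a2 [b [/le_X a1X /le_X a2X /le_X bX a20 xE]]]] := coords rho tau x rho1
    ball xK xcub.
  pose w i := if i == 0%N then a1 else if i == k then b else a2.
  apply/codomP; exists [ffun i : 'I_k.+1 => inord (absz (w i + X%:Z))].
  have zE i : (i <= k)%N ->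
    z [ffun i : 'I_k.+1 => inord (absz (w i + X%:Z))] i = w i.
    move=> ik; rewrite /z ffunE (inordK (ik : (i < k.+1)%N)).
    have wX : (`|w i| <= X)%N by rewrite /w; case: ifP => // _; case: ifP.
    by rewrite inordK; move: wX; lia.
  rewrite -xcub /t !zE // /w /= eqxx (gtn_eqF k0) xE; case: eqP => [k1|k1].
    by rewrite (a20 k1).
  by have -> : (1%N == k) = false by apply/eqP => /esym.
apply: (@le_trans _ _ ((X + X).+1%:R ^+ k.+1)).
  rewrite -natrX ler_nat; apply: (leq_trans (card_fset_set_le sub)).
  by rewrite size_codom card_ffun !card_ord.
apply: lerXn2r; rewrite ?nnegrE //; last by rewrite -natr1 natrD; lra.
by rewrite -mulrA mulr_ge0 // (le_trans _ Crho1).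
Qed.

Theorem theorem4p1 (R : realType) (K : divringClosed R) (k : nat)
    (v : 'I_k -> R) (hv : is_Qbasis K v) (hk : (k <= 2)%N) :
  exists2 C : R, 0 < C &
    \forall r \near +oo,
      `|density K v r| <= C * `|r `^ (- (2 / 3) * (k%:R + 1))|.
Proof.
have [C C0 num_le] := Tri_height_ball_card_le hv hk.
have [m m0 den_ge] : exists2 m : nat, (0 < m)%N & forall (N : nat) (r : R),
    (m * N)%:R <= r ->
    (N ^ k.+1 <= 8 * #|` fset_set (height_ball K v r `&` `[(-2)%R, 2%R])|)%N.
  by case: k v hv {hk num_le} (Qbasis_gt0 hv) => // k v hv _;
    exact: height_ball_card_ge.
have mR : 0 < m%:R :> R by rewrite ltr0n.
(* The quotient of [(C rho)^(k+1)] by [(r / (2 m))^(k+1) / 8], where [r = rho^3], leaves this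
   constant times [rho^(-2(k+1))]. *)
exists (8 * (2 * m%:R * C) ^+ k.+1).
  by rewrite mulr_gt0 // exprn_gt0 // !mulr_gt0.
near=> r.
have r1 : 1 <= r by near: r; exact: nbhs_pinfty_ge.
(* Ensures that rounding [r / m] down to [N] loses at most half. *)
have rm : 2 * m%:R <= r by near: r; exact: nbhs_pinfty_ge.
have r0 : 0 < r by exact: lt_le_trans r1.
pose rho := r `^ (3^-1).
have rho0 : 0 < rho by exact: powR_gt0.
have rho3 : rho ^+ 3 = r.
  by rewrite -powR_mulrn ?powR_ge0 // -powRrM mulVf ?pnatr_eq0 // powRr1 // ltW.
have rho1 : 1 <= rho.
  by rewrite -(@ler_pXn2r _ 3) // ?nnegrE ?(ltW rho0) // expr1n rho3.
have powE : r `^ (- (2 / 3) * (k%:R + 1)) = (rho ^+ 2) ^- k.+1.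
  rewrite -exprM -powR_invn ?powR_ge0 // -powRrM; congr (_ `^ _).
  rewrite natrM -natr1; by field.
rewrite powE ger0_norm; last by rewrite /density divr_ge0.
rewrite ger0_norm; last by rewrite invr_ge0 exprn_ge0 // exprn_ge0 // ltW.
pose N := Num.trunc (r / m%:R).
have rm0 : 0 <= r / m%:R by rewrite divr_ge0 // ltW.
have /andP[Nle Nlt] := truncn_itv rm0.
have Nr : (m * N)%:R <= r by rewrite natrM mulrC -ler_pdivlMr.
have N_ge : r / (2 * m%:R) <= N%:R.
  have : 2 <= r / m%:R by rewrite ler_pdivlMr.
  rewrite invfM mulrCA mulrC -/N; move: Nlt; rewrite -/N -natr1.
  lra.
have den := den_ge N r Nr.
rewrite /density; set D := (#|` fset_set (height_ball K v r `&` _)|)%N in den *.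
have := num_le rho rho1; rewrite rho3; set A := (_ %:R) => A_le.
have q0 : 0 < r / (2 * m%:R) by rewrite divr_gt0 // mulr_gt0.
have D_ge : (r / (2 * m%:R)) ^+ k.+1 / 8 <= D%:R.
  rewrite ler_pdivrMr // [leRHS]mulrC.
  apply: (@le_trans _ _ (N ^ k.+1)%:R); last by rewrite -(natrM _ 8) ler_nat.
  by rewrite natrX; apply: lerXn2r; rewrite ?nnegrE // ltW.
have D0 : 0 < D%:R :> R.
  by apply: lt_le_trans D_ge; rewrite divr_gt0 // exprn_gt0.
rewrite ler_pdivrMr //; apply: (le_trans A_le).
apply: (@le_trans _ _ (8 * (2 * m%:R * C) ^+ k.+1 * (rho ^+ 2) ^- k.+1
  * ((r / (2 * m%:R)) ^+ k.+1 / 8))); last first.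
  rewrite ler_wpM2l // mulr_ge0 //;
    first by rewrite mulr_ge0 // exprn_ge0 // ltW // !mulr_gt0.
  by rewrite invr_ge0 exprn_ge0 // exprn_ge0 // ltW.
rewrite -exprVn.
have -> : 8 * (2 * m%:R * C) ^+ k.+1 * (rho ^+ 2)^-1 ^+ k.+1
    * ((r / (2 * m%:R)) ^+ k.+1 / 8)
  = ((2 * m%:R * C) ^+ k.+1 * (rho ^+ 2)^-1 ^+ k.+1 * (r / (2 * m%:R)) ^+ k.+1).
  by field.
rewrite -!exprMn -rho3.
rewrite (_ : 2 * m%:R * C * (rho ^+ 2)^-1 * (rho ^+ 3 / (2 * m%:R)) = C * rho) //.
by field; rewrite !gt_eqF.
Unshelve. all: by end_near.
Qed.
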